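(* Let $X$ be a sequentially complete locally convex space and let $A\in L(X)$. Assume that for every $R>0$ and every $p\in\mathrm{cs}(X)$ there exist $q\in\mathrm{cs}(X)$ and a sequence $(\mu_n)_{n\in\mathbb{N}_0}$ of numbers $\mu_n>0$ such that $$p(A^nx)\leqslant \mu_n\,q(x)\ \text{ for all } n\in\mathbb{N}_0 \text{ and all } x\in X,\qquad\text{and}\qquad \sum_{n=0}^{\infty}\frac{\mu_n}{n!}R^n<\infty .$$ Then $A$ is the generator of a uniformly continuous $C_0$-semigroup $(T(t))_{t\geqslant 0}$ on $X$, and this semigroup is given, for every $t\geqslant 0$, by $$T(t)=\sum_{n=0}^{\infty}\frac{t^n}{n!}A^n,$$ where the series converges in $L_b(X)$.
   Context: Locally convex spaces are, as usual, Hausdorff. $\mathrm{cs}(X)$ denotes the system of all continuous seminorms on $X$. $L(X)$ denotes the space of all linear and continuous maps from $X$ into itself. $L_b(X)$ denotes $L(X)$ endowed with the topology of uniform convergence on the bounded subsets of $X$, given by the seminorms $q_B(S)=\sup_{x\in B}q(Sx)$ for $S\in L(X)$, where $B\subseteq X$ is bounded and $q\in\mathrm{cs}(X)$. A $C_0$-semigroup $(T(t))_{t\geqslant0}$ on $X$ is a family of maps $T(t)\in L(X)$ such that $T(0)=\mathrm{id}_X$, $T(t+s)=T(t)T(s)$ for $t,s\geqslant 0$, and $\lim_{t\to t_0}T(t)x=T(t_0)x$ for all $x\in X$ and $t_0\geqslant 0$. It is called uniformly continuous if the map $T(\cdot)\colon[0,\infty)\to L_b(X)$ is continuous. Its generator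 is the operator $A\colon D(A)\to X$ given by $Ax=\lim_{t\searrow 0}\frac{T(t)x-x}{t}$ on $D(A)=\{x\in X : \lim_{t\searrow 0}\frac{T(t)x-x}{t}\text{ exists}\}$. An operator $A\in L(X)$ generates the semigroup if it equals this generator (in particular $D(A)=X$). *)

(* Defs.v *)
From HB Require Import structures.
From mathcomp Require Import all_boot all_order all_algebra.
From mathcomp Require Import all_classical all_reals all_analysis.
From mathcomp Require Import complex.

Set Implicit Arguments.
Unset Strict Implicit.
Unset Printing Implicit Defensive.

Import Order.TTheory GRing.Theory Num.Theory.
Import numFieldNormedType.Exports.

Local Open Scope classical_set_scope.
Local Open Scope ring_scope.

(* Locally convex spaces are taken over the real or the complex numbers;
   seminorms, time and all constants are real-valued in both cases. *)
Variant scalar_kind := RealScalars | ComplexScalars.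

Definition scalars (R : realType) (k : scalar_kind) : numFieldType :=
  match k with
  | RealScalars => R
  | ComplexScalars => R[i]
  end.

Definition of_real (R : realType) (k : scalar_kind) : R -> scalars R k :=
  match k return R -> scalars R k with
  | RealScalars => fun t => t
  | ComplexScalars => fun t => (t%:C)%C
  end.
Arguments of_real {R} k t.

Section LocallyConvex.
Context {R : realType} {k : scalar_kind} {X : tvsType (scalars R k)}.
Implicit Types (p q : X -> R) (B : set X) (S A : X -> X) (T : R -> X -> X).

(* The norm of [scalars R k] takes its values in [scalars R k], hence the
   embedding of [p] in the homogeneity axiom. *)
Definition seminorm p : Prop :=
  [/\ forall x, 0 <= p x,
      forall x y, p (x + y) <= p x + p y &
      forall (a : scalars R k) x, of_real k (p (a *: x)) = `|a| * of_real k (p x)].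

Definition cs : set (X -> R) := [set p | seminorm p /\ continuous p].

Definition tvs_bounded B : Prop :=
  forall U : set X, nbhs (0 : X) U ->
    exists2 r : R, 0 < r & B `<=` [set of_real k r *: u | u in U].

(* [tvsType] does not tie its entourages to the additive structure, so the
   library's [cauchy] is not the right notion here: Cauchy sequences are
   expressed by translated neighbourhoods of 0. *)
Definition cauchy_sequence (u : nat -> X) : Prop :=
  forall U : set X, nbhs (0 : X) U ->
    exists N : nat, forall m n : nat, (N <= m)%N -> (N <= n)%N -> U (u m - u n).

(* The underlying set of L(X). *)
Definition continuous_linear : set (X -> X) :=
  [set S | linear S /\ continuous S].

(* [sup] is 0 on sets without a supremum; this only happens for empty [B] when
   [q] is a continuous seminorm, [B] is bounded and [S] is continuous linear. *)
Definition Lb_seminorm q B S : R := sup [set q (S x) | x in B].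

(* Convergence of a filter [F] of operators to [S] in L_b(X). *)
Definition Lb_cvg (F : set_system (X -> X)) S : Prop :=
  forall q B, cs q -> tvs_bounded B ->
    Lb_seminorm q B (S' - S) @[S' --> F] --> (0 : R).

(* A semigroup is indexed by all of [R]; only its values at t >= 0 matter. *)
Definition C0_semigroup T : Prop :=
  [/\ forall t : R, 0 <= t -> continuous_linear (T t),
      forall x, T 0 x = x,
      forall t s : R, 0 <= t -> 0 <= s -> T (t + s) = T t \o T s &
      forall x (t0 : R), 0 <= t0 ->
        T t x @[t --> within [set t : R | 0 <= t] (nbhs t0)] --> T t0 x].

Definition uniformly_continuous_semigroup T : Prop :=
  C0_semigroup T /\
  forall t0 : R, 0 <= t0 ->
    Lb_cvg (T t @[t --> within [set t : R | 0 <= t] (nbhs t0)]) (T t0).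

Definition generator_value T (x y : X) : Prop :=
  of_real k t^-1 *: (T t x - x) @[t --> (0 : R)^'+] --> y.

Definition generator_domain T : set X :=
  [set x | exists y, generator_value T x y].

Definition generates A T : Prop :=
  generator_domain T = setT /\ forall x, generator_value T x (A x).

End LocallyConvex.

Definition sequentially_complete (R : realType) (k : scalar_kind)
    (X : tvsType (scalars R k)) : Prop :=
  forall u : nat -> X, cauchy_sequence u -> exists l : X, u @ \oo --> l.

(* Main.v *)
Require Import Defs.
From HB Require Import structures.
From mathcomp Require Import all_boot all_order all_algebra.
From mathcomp Require Import all_classical all_reals all_analysis.
From mathcomp Require Import complex.
From mathcomp Require Import ring lra zify.

(** The semigroup is the exponential series of A, and every assertion about it
is a seminorm estimate on partial sums, obtained from one inequality and then
carried to the limit.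

The inequality is [power_sum_bound].  Fix r > 0 and a continuous seminorm p.
The growth hypothesis for r gives a continuous seminorm q such that, as soon as
the real coefficients a_n satisfy |a_n| <= c r^n / n! on a range of indices,
the sum of the a_n A^n x over that range has p-size at most c * q x.  The
seminorm q depends neither on the range, nor on the coefficients, nor on x, so
each of the following properties reduces to an estimate of real coefficients
with a suitable constant c.
 - For 0 <= t <= r, t^n / n! <= 2^-m (2r)^n / n! when n >= m
   ([expc_tail]).  The hypothesis for 2r then shows that the partial sums are
   Cauchy, at a geometric rate relative to q; sequential completeness gives the
   operators [exp_op A t].  The rate relative to q is uniform on bounded sets,
   which is convergence in L_b(X), and it also bounds p (T(t) x) by a continuous
   seminorm of x, which is continuity of T(t).
 - |t^n - s^n| / n! <= |t - s| (2r)^n / n! for s, t in [0, r], r >= 1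
   ([expc_lipschitz]): the semigroup is locally Lipschitz in time relative to q,
   hence uniformly continuous.
 - t^n / n! <= t^2 / n! for n >= 2 and 0 <= t <= 1 ([expc_quadratic]):
   T(t) x = x + t A x up to t^2 q x, so every x is in the domain of the
   generator, which is A.
 - The product of the partial sums of order N at t and s has at A^n the
   coefficient (t + s)^n / n! if n < N, and a coefficient between 0 and
   (t + s)^n / n! otherwise ([expc_prodE], [expc_prod_bounds]).  It differs from
   the partial sum at t + s only by terms of index at least N, which are again
   of order 2^-N: this is the law T(t + s) = T(t) T(s).

Passing between the topology of X and its continuous seminorms requires that
every neighbourhood of 0 contain the open unit ball of a continuous seminorm
([nbhs0_cs]); local convexity, which provides convex but not balanced
neighbourhoods, gives it through the gauge of a balanced core.  The Hausdorff
property enters only as the fact that continuous seminorms separate points. *)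

Set Implicit Arguments.
Unset Strict Implicit.
Unset Printing Implicit Defensive.

Import Order.TTheory GRing.Theory Num.Theory.
Import numFieldNormedType.Exports.
Local Open Scope classical_set_scope.
Local Open Scope ring_scope.

(** * Real constants as scalars *)

Section Scalars.
Context {R : realType} {k : scalar_kind}.
Implicit Types r s : R.
Local Notation of_real := (@of_real R k).

Fact of_real_is_zmod_morphism : zmod_morphism of_real.
Proof. by move=> r s; case: k => //=; rewrite rmorphB. Qed.

Fact of_real_is_monoid_morphism : monoid_morphism of_real.
Proof. by split=> [|r s]; case: k => //=; rewrite rmorphM. Qed.

HB.instance Definition _ :=
  GRing.isZmodMorphism.Build R (scalars R k) of_real of_real_is_zmod_morphism.
HB.instance Definition _ :=
  GRing.isMonoidMorphism.Build R (scalars R k) of_real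
    of_real_is_monoid_morphism.

Lemma ler_of_real r s : (of_real r <= of_real s) = (r <= s).
Proof. by case: k => //=; rewrite lecR. Qed.

Lemma ltr_of_real r s : (of_real r < of_real s) = (r < s).
Proof. by case: k => //=; rewrite ltcR. Qed.

Lemma of_real_gt0 r : (0 < of_real r) = (0 < r).
Proof. by rewrite -(rmorph0 of_real) ltr_of_real. Qed.

Lemma of_real_ge0 r : (0 <= of_real r) = (0 <= r).
Proof. by rewrite -(rmorph0 of_real) ler_of_real. Qed.

Lemma of_real_le1 r : (of_real r <= 1) = (r <= 1).
Proof. by rewrite -(rmorph1 of_real) ler_of_real. Qed.

Lemma normr_of_real r : `|of_real r| = of_real `|r|.
Proof.
by case: k => //=; rewrite normc_def /= expr0n /= addr0 sqrtr_sqr.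
Qed.

Lemma of_real_inj : injective of_real.
Proof. by move=> r s /eqP; rewrite eq_le !ler_of_real -eq_le => /eqP. Qed.

Lemma ger0_of_realP (a : scalars R k) :
  0 <= a -> exists2 r, 0 <= r & a = of_real r.
Proof.
case: k a => /= a a0; first by exists a.
move: a0; case: a => x y; rewrite lecE /= => /andP[/eqP -> x0].
by exists x.
Qed.

End Scalars.

(** * Seminorms *)

Section Seminorms.
Context {R : realType} {k : scalar_kind} {X : tvsType (scalars R k)}.
Implicit Types (p q : X -> R) (x y : X) (U V : set X).
Local Notation of_real := (@of_real R k).

Section SeminormTheory.
Variables (p : X -> R) (p_semi : seminorm p).

Lemma seminorm_ge0 x : 0 <= p x.
Proof. by case: p_semi. Qed.

Lemma seminormD x y : p (x + y) <= p x + p y.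
Proof. by case: p_semi. Qed.

Lemma seminormZ r x : p (of_real r *: x) = `|r| * p x.
Proof.
case: p_semi => _ _ pZ; apply: (@of_real_inj _ k).
by rewrite pZ normr_of_real -rmorphM.
Qed.

Lemma seminorm0 : p 0 = 0.
Proof. by rewrite -(scaler0 _ (of_real 0)) seminormZ normr0 mul0r. Qed.

Lemma seminormN x : p (- x) = p x.
Proof.
by rewrite -scaleN1r -(rmorph1 of_real) -rmorphN seminormZ normrN1 mul1r.
Qed.

Lemma seminormC x y : p (x - y) = p (y - x).
Proof. by rewrite -opprB seminormN. Qed.

Lemma seminormB x y : p (x - y) <= p x + p y.
Proof. by rewrite -(seminormN y) seminormD. Qed.

Lemma seminorm_dist x y : `|p x - p y| <= p (x - y).
Proof.
rewrite ler_norml lerBlDr; apply/andP; split; last first.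
  by rewrite -{1}(subrK y x) seminormD.
by rewrite lerNl opprB lerBlDr seminormC -{1}(subrK x y) seminormD.
Qed.

Lemma seminorm_sum (I : Type) (r : seq I) (P : pred I) (F : I -> X) :
  p (\sum_(i <- r | P i) F i) <= \sum_(i <- r | P i) p (F i).
Proof.
elim/big_ind2 : _ => [|u1 v1 u2 v2 h1 h2|//]; first by rewrite seminorm0.
by rewrite (le_trans (seminormD _ _))// lerD.
Qed.

(** By the triangle inequality, continuity at 0 is enough, and homogeneity
reduces it to a bound on a single neighbourhood. *)
Lemma seminorm_continuous : nbhs (0 : X) [set x | p x <= 1] -> continuous p.
Proof.
move=> nb1 x; apply/cvgrPdist_le => e e0.
have e0' : of_real e != 0 by rewrite gt_eqF// of_real_gt0.
have := nbhsT x (nbhs0Z e0' nb1).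
apply: filterS => _ [_ [z pz <-] <-].
rewrite (le_trans (seminorm_dist _ _))// opprD addrA subrr sub0r seminormN.
by rewrite seminormZ gtr0_norm// ger_pMr.
Qed.

End SeminormTheory.
End Seminorms.

(** * Continuous seminorms from convex neighbourhoods *)

Section Gauge.
Context {R : realType} {k : scalar_kind} {X : tvsType (scalars R k)}.
Implicit Types (p q : X -> R) (x y : X) (U V W : set X).
Local Notation of_real := (@of_real R k).

(** A convex neighbourhood of 0 need not be balanced; this is its largest
balanced subset. *)
Definition balanced_core V : set X :=
  [set x | forall a : scalars R k, `|a| <= 1 -> V (a *: x)].

Definition gauge W x : R := inf [set t : R | 0 < t /\ W (of_real t^-1 *: x)].

Lemma balanced_core_sub V : balanced_core V `<=` V.
Proof. by move=> x /(_ 1); rewrite normr1 scale1r; apply. Qed.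

Lemma balanced_coreZ V (a : scalars R k) x :
  `|a| <= 1 -> balanced_core V x -> balanced_core V (a *: x).
Proof.
by move=> a1 Vx b b1; rewrite scalerA; apply: Vx; rewrite normrM mulr_ile1.
Qed.

Lemma balanced_core_conv V (r : R) x y :
  convex_set (V : set (convex_lmodType X)) -> 0 <= r <= 1 ->
  balanced_core V x -> balanced_core V y ->
  balanced_core V (of_real r *: x + of_real (1 - r) *: y).
Proof.
move=> cV /andP[r0 r1] Vx Vy a a1.
have r0' : 0 <= of_real r by rewrite of_real_ge0.
have r1' : of_real r <= 1 by rewrite of_real_le1.
have := cV (a *: x) (a *: y) (Itv01 r0' r1').
rewrite !inE => /(_ (Vx a a1) (Vy a a1)).
rewrite rmorphB rmorph1 scalerDr !scalerA [a * of_real r]mulrC.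
by rewrite [a * (1 - _)]mulrC -!scalerA.
Qed.

Lemma nbhs0_scale_small (V : set X) x : nbhs (0 : X) V ->
  exists2 e : R, 0 < e &
    forall a : scalars R k, `|a| <= of_real e -> V (a *: x).
Proof.
move=> V0; have := @scale_continuous _ X (0, x) V; rewrite scale0r => /(_ V0).
move=> [[B1 B2]] /= [[e /= e0 eB1] B2x] BV.
have [r r0 er] := ger0_of_realP (ltW e0).
have r1 : 0 < r by rewrite -(@of_real_gt0 _ k) -er.
exists (r / 2) => [|a ar]; first by rewrite divr_gt0.
apply: (BV (a, x)); split => /=; last exact: nbhs_singleton.
apply: eB1 => /=; rewrite sub0r normrN (le_lt_trans ar)// er ltr_of_real.
by rewrite gtr_pMr// invf_lt1// ltr1n.
Qed.

(** Joint continuity of the scaling at (0, 0) gives a ball of radius e and a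
neighbourhood B2 of 0 whose product is sent into V; then (e / 2) B2 lies in
the core. *)
Lemma nbhs0_balanced_core V : nbhs (0 : X) V -> nbhs (0 : X) (balanced_core V).
Proof.
move=> V0; have := @scale_continuous _ X (0, 0) V; rewrite scale0r => /(_ V0).
move=> [[B1 B2]] /= [[e /= e0 eB1] B2x] BV.
have e20 : e / 2 != 0 by rewrite gt_eqF// divr_gt0.
apply: filterS (nbhs0Z e20 B2x) => _ [x Bx <-] a a1; rewrite scalerA.
apply: (BV (_, x)); split => //=; apply: eB1 => /=.
rewrite sub0r normrN normrM (@gtr0_norm _ (e / 2)) ?divr_gt0//.
rewrite (@le_lt_trans _ _ (e / 2))//; first by rewrite ger_pMl// divr_gt0.
by rewrite gtr_pMr// invf_lt1// ltr1n.
Qed.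

Section GaugeSeminorm.
Variable V : set X.
Hypotheses (V0 : nbhs (0 : X) V)
  (cV : convex_set (V : set (convex_lmodType X))).
Let W := balanced_core V.
Let p := gauge W.

Let S x := [set t : R | 0 < t /\ W (of_real t^-1 *: x)].

Let S_inf x : has_inf (S x).
Proof.
split; last by exists 0 => t [/ltW].
have [e e0 eW] := nbhs0_scale_small x (nbhs0_balanced_core V0).
exists e^-1; split; first by rewrite invr_gt0.
by apply: eW; rewrite invrK normr_of_real gtr0_norm.
Qed.

Let gauge_ge0 x : 0 <= p x.
Proof. by apply: lb_le_inf => [|t [/ltW//]]; case: (S_inf x). Qed.

Let gauge_le x t : 0 < t -> W (of_real t^-1 *: x) -> p x <= t.
Proof. by move=> t0 Wt; apply: ge_inf => //; case: (S_inf x). Qed.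

Let gauge_lt x t : p x < t -> W (of_real t^-1 *: x).
Proof.
move=> pt; have [//|s [s0 Ws] st] := @inf_lt _ (S x) t _ pt.
  by case: (S_inf x).
have t0 : 0 < t by exact: lt_trans st.
(* x / t is (s / t) (x / s), and the core is balanced. *)
have -> : of_real t^-1 *: x = of_real (t^-1 * s) *: (of_real s^-1 *: x).
  by rewrite scalerA -rmorphM -mulrA divff ?gt_eqF// mulr1.
apply: balanced_coreZ => //.
rewrite normr_of_real of_real_le1 gtr0_norm; last first.
  by rewrite mulr_gt0// invr_gt0.
by rewrite ler_pdivrMl// mulr1 ltW.
Qed.

Let gaugeD x y : p (x + y) <= p x + p y.
Proof.
apply/ler_addgt0Pr => e e0.
set s := p x + e / 2; set t := p y + e / 2.
have s0 : 0 < s by rewrite ltr_wpDl// divr_gt0.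
have t0 : 0 < t by rewrite ltr_wpDl// divr_gt0.
have st0 : 0 < s + t by rewrite addr_gt0.
have -> : p x + p y + e = s + t by rewrite /s /t; lra.
apply: gauge_le => //.
(* (x + y) / (s + t) is a convex combination of x / s and y / t. *)
have -> : of_real (s + t)^-1 *: (x + y) =
    of_real (s / (s + t)) *: (of_real s^-1 *: x) +
    of_real (1 - s / (s + t)) *: (of_real t^-1 *: y).
  rewrite scalerDr !scalerA -!rmorphM; congr (of_real _ *: _ + of_real _ *: _).
    by field; rewrite !gt_eqF.
  by field; rewrite !gt_eqF.
apply: balanced_core_conv => //.
- by rewrite divr_ge0 ?(ltW s0) ?(ltW st0)//= ler_pdivrMr// mul1r lerDl ltW.
- by apply: gauge_lt; rewrite /s ltrDl divr_gt0.
- by apply: gauge_lt; rewrite /t ltrDl divr_gt0.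
Qed.

Let gauge_homo_le (a : scalars R k) r x : 0 < r -> `|a| = of_real r ->
  p (a *: x) <= r * p x.
Proof.
move=> r0 ar; apply/ler_addgt0Pr => e e0.
have pe : p x < p x + e / r by rewrite ltrDl divr_gt0.
have pe0 : 0 < p x + e / r by exact: le_lt_trans pe.
have -> : r * p x + e = r * (p x + e / r) by field; rewrite gt_eqF.
apply: gauge_le; first by rewrite mulr_gt0.
have -> : of_real (r * (p x + e / r))^-1 *: (a *: x) =
   (of_real r^-1 * a) *: (of_real (p x + e / r)^-1 *: x).
  by rewrite invfM rmorphM !scalerA mulrAC.
apply: balanced_coreZ; last exact: gauge_lt.
rewrite normrM ar normr_of_real gtr0_norm ?invr_gt0// -rmorphM mulVf ?gt_eqF//.
by rewrite rmorph1.
Qed.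

Let gauge0 : p 0 = 0.
Proof.
apply/eqP; rewrite eq_le gauge_ge0 andbT; apply/ler_addgt0Pr => e e0.
rewrite add0r; apply: gauge_le => //; rewrite scaler0.
exact: (nbhs_singleton (nbhs0_balanced_core V0)).
Qed.

(** Convexity of the core gives subadditivity, and invariance of the core under
scalars of modulus 1 gives homogeneity for all scalars, not only the positive
ones. *)
Lemma seminorm_gauge : seminorm p.
Proof.
split=> // a x; have [r r0 ar] := ger0_of_realP (normr_ge0 a).
rewrite ar -rmorphM; congr (of_real _).
move: r0; rewrite le_eqVlt => /orP[/eqP r0|r0].
  move: ar; rewrite -r0 rmorph0 => /normr0_eq0 ->.
  by rewrite scale0r gauge0 mul0r.
have a0 : a != 0 by rewrite -normr_gt0 ar of_real_gt0.
apply/eqP; rewrite eq_le gauge_homo_le//=.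
(* The converse inequality is the previous one for the scalar 1 / a. *)
rewrite -[x in leLHS](scalerK a0) mulrC -ler_pdivlMr// mulrC.
by apply: gauge_homo_le; rewrite ?invr_gt0// normfV ar fmorphV.
Qed.

Lemma continuous_gauge : continuous p.
Proof.
apply: (seminorm_continuous seminorm_gauge).
apply: filterS (nbhs0_balanced_core V0) => x Wx.
by apply: gauge_le => //; rewrite invr1 rmorph1 scale1r.
Qed.

Lemma gauge_lt1_sub x : p x < 1 -> V x.
Proof.
by move/gauge_lt; rewrite invr1 rmorph1 scale1r => /balanced_core_sub.
Qed.

End GaugeSeminorm.

(** The topology is generated by the continuous seminorms: this is where local
convexity is used. *)
Lemma nbhs0_cs U : nbhs (0 : X) U ->
  exists2 p, cs p & forall x, p x < 1 -> U x.
Proof.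
move=> U0; have [B cB [Bo Bb]] := @locally_convex _ X.
have [V [BV V0] VU] := Bb 0 U U0.
have nV : nbhs (0 : X) V by apply: open_nbhs_nbhs; split => //; exact: Bo.
have cV : convex_set (V : set (convex_lmodType X)) by apply: cB; rewrite inE.
exists (gauge (balanced_core V)) => [|x /(gauge_lt1_sub nV) /VU//].
by split; [exact: seminorm_gauge|exact: continuous_gauge].
Qed.

End Gauge.

(** * Convergence and boundedness through seminorms *)

Section SeminormConvergence.
Context {R : realType} {k : scalar_kind} {X : tvsType (scalars R k)}.
Implicit Types (p q : X -> R) (x y : X) (B : set X).
Local Notation of_real := (@of_real R k).

Lemma nbhs_cs_ball p x (e : R) :
  cs p -> 0 < e -> nbhs x [set y | p (y - x) < e].
Proof.
move=> [ps pc] e0; have n0 : nbhs (0 : X) [set z | p z < e].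
  have /cvgr_lt := pc 0; rewrite (seminorm0 ps); exact.
by apply: filterS (nbhsT x n0) => _ [z pz <-] /=; rewrite addrC addKr.
Qed.

Lemma cvg_cs_lt (T : Type) (F : set_system T) {FF : Filter F} (f : T -> X) x
    p (e : R) :
  f @ F --> x -> cs p -> 0 < e -> \forall t \near F, p (f t - x) < e.
Proof. by move=> fx p_cs e0; exact: (fx _ (nbhs_cs_ball x p_cs e0)). Qed.

Lemma cvg_cs (T : Type) (F : set_system T) {FF : Filter F} (f : T -> X) x :
  (forall p, cs p -> forall e : R, 0 < e ->
    \forall t \near F, p (f t - x) < e) ->
  f @ F --> x.
Proof.
move=> fx U /(nbhsB (- x)); rewrite addNr => /nbhs0_cs[p p_cs pU].
apply: filterS (fx p p_cs 1 ltr01) => t /pU[y Uy]; rewrite addrC.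
by move=> /addIr fty; rewrite /= -fty.
Qed.

Lemma csZ p (c : R) : 0 <= c -> cs p -> cs (fun x => c * p x).
Proof.
move=> c0 [[p0 pD pZ] pc]; split; last first.
  by move=> x; apply: cvgMr; exact: pc.
split=> [x|x y|a x]; first by rewrite mulr_ge0.
  by rewrite -mulrDr ler_wpM2l.
by rewrite /= !rmorphM/= pZ mulrCA.
Qed.

Lemma tvs_bounded_cs B q : tvs_bounded B -> cs q ->
  exists2 r : R, 0 < r & forall x, B x -> q x <= r.
Proof.
move=> bB q_cs; have [r r0 Br] := bB _ (nbhs_cs_ball 0 q_cs ltr01).
exists r => // x /Br[y /= qy <-]; rewrite subr0 in qy.
case: q_cs => qs _; rewrite (seminormZ qs) gtr0_norm//.
by rewrite ger_pMr// ltW.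
Qed.

Lemma Lb_seminorm_le q B (S : X -> X) (C : R) : cs q -> 0 <= C ->
  (forall x, B x -> q (S x) <= C) -> `|Lb_seminorm q B S| <= C.
Proof.
move=> [qs _] C0 qC; rewrite /Lb_seminorm.
have [->|/set0P[x Bx]] := eqVneq B set0.
  by rewrite image_set0 sup0 normr0.
have ubC : ubound [set q (S x) | x in B] C by move=> _ [y By <-]; exact: qC.
have sup_le : sup [set q (S x) | x in B] <= C.
  by apply: ge_sup => //; exists (q (S x)), x.
rewrite ger0_norm// (le_trans (seminorm_ge0 qs (S x)))// ub_le_sup//.
  by exists C.
by exists x.
Qed.

(** An error at most e * q x, with q the same for all e, is uniform on bounded
sets because q is bounded on them.  All convergences in L_b(X) are obtained
this way, without reference to a bounded set. *)
Lemma Lb_cvg_relative (F : set_system (X -> X)) {FF : Filter F} (S : X -> X) :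
  (forall p, cs p -> exists2 q, cs q & forall e : R, 0 < e ->
     \forall S' \near F, forall x, p (S' x - S x) <= e * q x) ->
  Lb_cvg F S.
Proof.
move=> H p B p_cs bB; have [q q_cs qF] := H p p_cs.
have [r r0 qr] := tvs_bounded_cs bB q_cs.
apply/cvgr0Pnorm_le => e e0.
apply: filterS (qF (e / r) _); last exact: divr_gt0.
move=> S' HS'; apply: Lb_seminorm_le => //; first exact: ltW.
move=> x Bx; rewrite (le_trans (HS' x))//.
by rewrite mulrAC ler_pdivrMr// ler_wpM2l ?qr// ltW.
Qed.

(** The step from estimates on partial sums to estimates on operators. *)
Lemma cvg_seminorm_le p (u v : nat -> X) x y (C : R) : cs p ->
  u @ \oo --> x -> v @ \oo --> y ->
  (\forall n \near \oo, p (u n - v n) <= C) -> p (x - y) <= C.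
Proof.
move=> p_cs ux vy uvC; apply/ler_addgt0Pr => e e0; have [ps _] := p_cs.
have e20 : 0 < e / 2 by rewrite divr_gt0.
have : \forall n \near \oo, p (x - y) <= C + e.
  have un : \forall n \near \oo, p (u n - x) < e / 2 by exact: cvg_cs_lt.
  have vn : \forall n \near \oo, p (v n - y) < e / 2 by exact: cvg_cs_lt.
  apply: filterS3 uvC un vn => n uvn un vn.
  have -> : x - y = (u n - v n) - (u n - x) + (v n - y).
    by rewrite opprB [X in X + (v n - y)]addrC !addrA !subrK.
  rewrite (le_trans (seminormD ps _ _))// (splitr e) addrA.
  rewrite lerD ?(ltW vn)// (le_trans (seminormB ps _ _))//.
  by rewrite lerD // ltW.
by case/filter_ex.
Qed.

Lemma cs_separating x y : hausdorff_space X ->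
  (forall p, cs p -> p (x - y) <= 0) -> x = y.
Proof.
move=> hX xy; apply: (cvg_unique hX (F := x @[_ --> \oo])).
  exact: cvg_cst.
apply: cvg_cs => p p_cs e e0; apply: nearW => _.
exact: le_lt_trans (xy p p_cs) e0.
Qed.

Lemma linear_continuous_cs (f : X -> X) : linear f ->
  (forall p, cs p -> exists2 q, cs q & forall x, p (f x) <= q x) ->
  continuous f.
Proof.
move=> f_lin f_le x; apply: cvg_cs => p p_cs e e0.
have [q q_cs pq] := f_le p p_cs.
apply: filterS (nbhs_cs_ball x q_cs e0) => y /=; apply: le_lt_trans.
have -> : f y - f x = f (y - x).
  by rewrite addrC -scaleN1r -f_lin scaleN1r addrC.
exact: pq.
Qed.

End SeminormConvergence.

(** * Coefficients of the exponential series *)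

Section ExpCoefficients.
Context {R : realType}.
Implicit Types (r s t : R) (n N : nat).

Definition expc t n : R := t ^+ n / n`!%:R.

Lemma expc_ge0 t n : 0 <= t -> 0 <= expc t n.
Proof. by move=> t0; rewrite divr_ge0// exprn_ge0. Qed.

Lemma expc_le s t n : 0 <= s <= t -> expc s n <= expc t n.
Proof.
move=> /andP[s0 st]; rewrite ler_wpM2r// lerXn2r// nnegrE//.
exact: le_trans st.
Qed.

(** Doubling r buys a geometric factor: t^n <= r^n = 2^-n (2 r)^n. *)
Lemma expc_tail t r n N : 0 <= t <= r -> (N <= n)%N ->
  expc t n <= 2^-1 ^+ N * expc (2 * r) n.
Proof.
move=> tr Nn; rewrite (le_trans (expc_le n tr))//.
have /andP[t0 /(le_trans t0) r0] := tr.
rewrite /expc exprMn !mulrA ler_wpM2r// ler_peMl ?exprn_ge0//.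
by rewrite exprVn ler_pdivlMl ?exprn_gt0// mulr1 ler_weXn2l// ler1n.
Qed.

(** In the factorization of t^n - s^n the second factor has n terms of size at
most r^(n-1) <= r^n, and n <= 2^n is absorbed in the radius 2 r. *)
Lemma expc_lipschitz s t r n : 0 <= s <= r -> 0 <= t <= r -> 1 <= r ->
  `|expc t n - expc s n| <= `|t - s| * expc (2 * r) n.
Proof.
move=> /andP[s0 sr] /andP[t0 tr] r1.
have r0 : 0 <= r by exact: le_trans r1.
rewrite /expc -mulrBl normrM mulrA (@ger0_norm _ _^-1) ?invr_ge0//.
rewrite ler_wpM2r ?invr_ge0// subrXX normrM ler_wpM2l//.
rewrite (le_trans (ler_norm_sum _ _ _))//.
apply: (@le_trans _ _ (\sum_(i < n) r ^+ n)).
  apply: ler_sum => i _; rewrite ger0_norm ?mulr_ge0 ?exprn_ge0//.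
  apply: (@le_trans _ _ (r ^+ (n.-1 - i) * r ^+ i)).
    by apply: ler_pM; rewrite ?exprn_ge0// lerXn2r// nnegrE.
  by rewrite -exprD ler_weXn2l//; have := ltn_ord i; lia.
rewrite sumr_const card_ord exprMn -[leLHS]mulr_natl ler_wpM2r ?exprn_ge0//.
by rewrite -natrX ler_nat ltnW// ltn_expl.
Qed.

Lemma expc_quadratic t n : 0 <= t <= 1 -> (2 <= n)%N ->
  expc t n <= t ^+ 2 * expc 1 n.
Proof.
move=> /andP[t0 t1] n2; rewrite /expc expr1n mul1r ler_wpM2r ?invr_ge0//.
by rewrite -(subnKC n2) exprD ler_piMr ?exprn_ile1 ?exprn_ge0.
Qed.

(** The coefficient of A^n in the product of the partial sums of order N of the
exponential series at t and at s. *)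
Definition expc_prod t s N n : R :=
  \sum_(0 <= i < N) \sum_(0 <= j < N | (i + j == n)%N) expc t i * expc s j.

(** For n < N no pair (i, j) with i + j = n is cut off, and the sum is the
binomial expansion of (t + s)^n / n!. *)
Lemma expc_prodE t s N n : (n < N)%N -> expc_prod t s N n = expc (t + s) n.
Proof.
move=> nN; rewrite /expc_prod addrC /expc exprDn mulr_suml.
rewrite (big_cat_nat (n := n.+1))//= [X in _ + X]big_nat_cond.
rewrite [X in _ + X]big1 ?addr0; last first.
  move=> i /andP[/andP[ni _] _]; rewrite big1// => j /eqP; lia.
rewrite big_mkord; apply: eq_bigr => i _.
have in_ : (i <= n)%N by rewrite -ltnS.
rewrite (eq_bigl (fun j => j == (n - i)%N)); last first.
  by move=> j /=; apply/eqP/eqP; lia.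
rewrite big_nat1_eq leq0n /=.
rewrite (_ : (n - i < N)%N) ?(leq_ltn_trans (leq_subr _ _))//.
rewrite -mulr_natr -(bin_fact in_) !natrM.
field.
by rewrite !pnatr_eq0 -!lt0n !fact_gt0 bin_gt0.
Qed.

(** All terms are nonnegative, so raising the cutoff above n, where the previous
lemma applies, can only increase the sum. *)
Lemma expc_prod_bounds t s N n : 0 <= t -> 0 <= s ->
  0 <= expc_prod t s N n <= expc (t + s) n.
Proof.
move=> t0 s0; have c0 i j : 0 <= expc t i * expc s j.
  by rewrite mulr_ge0// expc_ge0.
apply/andP; split.
  by apply: sumr_ge0 => i _; apply: sumr_ge0.
rewrite -(@expc_prodE t s (maxn N n.+1) n) ?leq_maxr//.
rewrite /expc_prod [leRHS](big_cat_nat (n := N)) ?leq_maxl//=.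
apply: ler_wpDr; first by apply: sumr_ge0 => i _; apply: sumr_ge0.
apply: ler_sum => i _; rewrite [leRHS](big_cat_nat (n := N)) ?leq_maxl//=.
by apply: ler_wpDr => //; apply: sumr_ge0.
Qed.

End ExpCoefficients.

(** * The exponential of an operator *)

Section ExponentialSeries.
Context {R : realType} {k : scalar_kind} {X : tvsType (scalars R k)}.
Implicit Types (A : X -> X) (p q : X -> R) (x y : X).
Implicit Types (r s t : R) (m n N : nat).
Local Notation of_real := (@of_real R k).

Lemma linear_sum_scale (f : X -> X) (I : Type) (s : seq I)
    (a : I -> scalars R k) (F : I -> X) : linear f ->
  f (\sum_(i <- s) a i *: F i) = \sum_(i <- s) a i *: f (F i).
Proof.
move=> f_lin; pose fM := GRing.isLinear.Build _ _ _ _ f f_lin.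
pose g : {linear X -> X} := HB.pack f fM.
rewrite -[f]/(g : X -> X) linear_sum; apply: eq_bigr => i _; exact: linearZ.
Qed.

(** Convergence of the series of the mu_n r^n / n! makes the exponential series
of A at time r absolutely convergent for p, uniformly relative to q. *)
Definition summable_powers A : Prop :=
  forall (r : R) (p : X -> R), 0 < r -> cs p ->
    exists (q : X -> R) (mu : nat -> R),
      [/\ cs q,
          forall n, 0 < mu n,
          forall n x, p (iter n A x) <= mu n * q x &
          cvgn (series (fun n => mu n / n`!%:R * r ^+ n))].

Section ExponentialOfOperator.
Variable A : X -> X.
Hypotheses (X_hausdorff : hausdorff_space X)
  (X_complete : sequentially_complete X)
  (A_L : continuous_linear A) (A_bound : summable_powers A).

(** All estimates below come from the growth hypothesis through this inequality.
The seminorm q of the hypothesis gets multiplied by the sum of the series of the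
mu_n r^n / n!. *)
Lemma power_sum_bound r p : 0 < r -> cs p ->
  exists2 q, cs q & forall (a : nat -> R) (c : R) m N x, 0 <= c ->
    (forall n, (m <= n < N)%N -> `|a n| <= c * (r ^+ n / n`!%:R)) ->
    p (\sum_(m <= n < N) of_real (a n) *: iter n A x) <= c * q x.
Proof.
move=> r0 p_cs; have [q [mu [q_cs mu0 pq cvg_mu]]] := A_bound r0 p_cs.
set u := (fun n => mu n / n`!%:R * r ^+ n) in cvg_mu.
have u0 n : 0 <= u n by rewrite mulr_ge0 ?exprn_ge0 ?divr_ge0 ?ltW.
have u_le n : \sum_(0 <= i < n) u i <= limn (series u).
  apply: nondecreasing_cvgn_le => //; apply/nondecreasing_seqP => i.
  by rewrite /series /= big_nat_recr//= lerDl.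
have uM0 : 0 <= limn (series u) by rewrite (le_trans _ (u_le 0%N))// big_nil.
exists (fun x => limn (series u) * q x) => [|a c m N x c0 ac]; first exact: csZ.
have [ps _] := p_cs; have qx0 : 0 <= q x by case: q_cs => -[].
rewrite (le_trans (seminorm_sum ps _ _ _))//.
apply: (@le_trans _ _ (\sum_(m <= n < N) c * u n * q x)).
  apply: ler_sum_nat => n /ac an; rewrite (seminormZ ps).
  apply: le_trans (ler_pM _ _ an (pq n x)) _ => //; first exact: seminorm_ge0.
  by rewrite [leLHS](_ : _ = c * u n * q x) /u; [exact: lexx | ring].
rewrite -mulr_suml -mulr_sumr -mulrA ler_wpM2l// ler_wpM2r//.
have [mN|Nm] := leqP m N; last by rewrite big_geq // ltnW.
apply: le_trans (u_le N); rewrite [leRHS](big_cat_nat (n := m))//=.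
by rewrite lerDr sumr_ge0.
Qed.

Definition exp_sum t N x : X :=
  \sum_(0 <= n < N) of_real (expc t n) *: iter n A x.

(** For t >= 0 the partial sums do have a limit, by [exp_sum_cvg]. *)
Definition exp_op t x : X :=
  xget 0 [set l | exp_sum t N x @[N --> \oo] --> l].

Lemma iter_linear n : linear (iter n A).
Proof.
by case: A_L => A_lin _ a x y; elim: n => //= n ->; rewrite A_lin.
Qed.

Lemma exp_sum_linear t N : linear (exp_sum t N).
Proof.
move=> a x y; rewrite scaler_sumr -big_split /=; apply: eq_bigr => n _.
by rewrite iter_linear scalerDr !scalerA mulrC.
Qed.

Lemma exp_sum_comp t s N x :
  exp_sum t N (exp_sum s N x) =
  \sum_(0 <= n < N + N) of_real (expc_prod t s N n) *: iter n A x.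
Proof.
(* The right-hand side becomes a sum over n, i and j restricted to i + j = n;
   the sum over n is done first. *)
under [RHS]eq_bigr => n _.
  rewrite rmorph_sum scaler_suml /=.
  under eq_bigr => i _ do rewrite rmorph_sum scaler_suml big_mkcond /=.
  over.
rewrite exchange_big_nat /=; apply: eq_big_nat => i iN.
rewrite exchange_big_nat /= {1}/exp_sum.
rewrite (linear_sum_scale _ _ _ (iter_linear i)).
rewrite scaler_sumr; apply: eq_big_nat => j jN.
rewrite -big_mkcond /= (eq_bigl (fun n => n == (i + j)%N)); last first.
  by move=> n /=; rewrite eq_sym.
rewrite big_nat1_eq /= (_ : (i + j < N + N)%N); last by lia.
by rewrite iterD scalerA -rmorphM.
Qed.

(** Geometric rate of convergence.  The case m = 0 also says that the partial
sums at all times in [0, r] are equicontinuous. *)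
Lemma exp_sum_tail_bound r p : 0 < r -> cs p ->
  exists2 q, cs q & forall t m N x, 0 <= t <= r -> (m <= N)%N ->
    p (exp_sum t N x - exp_sum t m x) <= 2^-1 ^+ m * q x.
Proof.
move=> r0 p_cs; have r20 : 0 < 2 * r by rewrite mulr_gt0.
have [q q_cs pq] := power_sum_bound r20 p_cs.
exists q => // t m N x tr mN.
rewrite {1}/exp_sum (big_cat_nat (n := m))//= addrAC subrr add0r.
apply: pq => [|n /andP[mn _]]; first by rewrite exprn_ge0.
rewrite ger0_norm ?expc_ge0//; last by case/andP: tr.
exact: expc_tail.
Qed.

Lemma exp_sum_lipschitz_bound r p : 1 <= r -> cs p ->
  exists2 q, cs q & forall s t N x, 0 <= s <= r -> 0 <= t <= r ->
    p (exp_sum t N x - exp_sum s N x) <= `|t - s| * q x.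
Proof.
move=> r1 p_cs; have r20 : 0 < 2 * r by rewrite mulr_gt0// (lt_le_trans _ r1).
have [q q_cs pq] := power_sum_bound r20 p_cs.
exists q => // s t N x sr tr; rewrite -sumrB.
under eq_bigr => n _ do rewrite -scalerBl -rmorphB.
by apply: pq => // n _; exact: expc_lipschitz.
Qed.

Lemma exp_sum2 t x : exp_sum t 2 x = x + of_real t *: A x.
Proof.
rewrite /exp_sum big_mkord !big_ord_recl big_ord0 addr0.
by rewrite /expc /= expr0 expr1 !divr1 rmorph1 scale1r.
Qed.

Lemma exp_sum_quadratic_bound p : cs p ->
  exists2 q, cs q & forall t N x, 0 <= t <= 1 -> (2 <= N)%N ->
    p (exp_sum t N x - (x + of_real t *: A x)) <= t ^+ 2 * q x.
Proof.
move=> p_cs; have [q q_cs pq] := power_sum_bound ltr01 p_cs.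
exists q => // t N x t01 N2; have /andP[t0 _] := t01.
rewrite -exp_sum2 {1}/exp_sum (big_cat_nat (n := 2%N))//= addrAC subrr add0r.
apply: pq => [|n /andP[n2 _]]; first by rewrite exprn_ge0.
by rewrite ger0_norm ?expc_ge0//; exact: expc_quadratic.
Qed.

(** The first N coefficients of the product agree with those of the sum at
t + s; the others are dominated by the tail at t + s. *)
Lemma exp_sum_semigroup_bound r p : 0 < r -> cs p ->
  exists2 q, cs q & forall s t N x, 0 <= s -> 0 <= t -> t + s <= r ->
    p (exp_sum t N (exp_sum s N x) - exp_sum (t + s) N x) <= 2^-1 ^+ N * q x.
Proof.
move=> r0 p_cs; have r20 : 0 < 2 * r by rewrite mulr_gt0.
have [q q_cs pq] := power_sum_bound r20 p_cs.
exists q => // s t N x s0 t0 tsr; rewrite exp_sum_comp.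
rewrite (big_cat_nat (n := N)) ?leq_addr//=.
rewrite [X in X + _ - _](_ : _ = exp_sum (t + s) N x); last first.
  by rewrite /exp_sum; apply: eq_big_nat => n /= nN; rewrite expc_prodE.
rewrite addrAC subrr add0r.
apply: pq => [|n /andP[Nn _]]; first by rewrite exprn_ge0.
have /andP[d0 d1] := expc_prod_bounds N n t0 s0.
rewrite ger0_norm// (le_trans d1)//; apply: expc_tail => //.
by rewrite addr_ge0.
Qed.

Lemma cvg_half_pow (C : R) : (2^-1 ^+ n * C : R) @[n --> \oo] --> (0 : R).
Proof.
rewrite -[X in _ --> X](mul0r C); apply: cvgMl.
by apply: cvg_expr; rewrite ger0_norm ?invr_ge0// invf_lt1// ltr1n.
Qed.

Lemma exp_sum_cvg t x : 0 <= t -> exp_sum t N x @[N --> \oo] --> exp_op t x.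
Proof.
move=> t0; suff /X_complete[l xl] : cauchy_sequence (exp_sum t ^~ x).
  by apply: (@xgetPex _ 0 [set l | exp_sum t N x @[N --> \oo] --> l]); exists l.
move=> U /nbhs0_cs[p p_cs pU].
have t10 : 0 < t + 1 by rewrite ltr_wpDl.
have [q q_cs pq] := exp_sum_tail_bound t10 p_cs.
have [M _ HM] := cvgr_lt _ (cvg_half_pow (q x)) _ ltr01.
have tt1 : 0 <= t <= t + 1 by rewrite t0/= lerDl.
exists M => m n Mm Mn; apply: pU; have [ps _] := p_cs.
wlog nm : m n Mm Mn / (n <= m)%N.
  move=> H; have [|/ltnW] := leqP n m; first exact: H.
  by rewrite (seminormC ps); apply: H.
exact: le_lt_trans (pq t n m x tt1 nm) (HM n Mn).
Qed.

Lemma exp_op_tail_bound r p : 0 < r -> cs p ->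
  exists2 q, cs q & forall t m x, 0 <= t <= r ->
    p (exp_op t x - exp_sum t m x) <= 2^-1 ^+ m * q x.
Proof.
move=> r0 p_cs; have [q q_cs pq] := exp_sum_tail_bound r0 p_cs.
exists q => // t m x tr; have /andP[t0 _] := tr.
apply: (cvg_seminorm_le (v := fun=> exp_sum t m x) p_cs (@exp_sum_cvg _ _ t0)).
  exact: cvg_cst.
by near=> N; apply: pq => //; near: N; exact: nbhs_infty_ge.
Unshelve. all: by end_near. Qed.

Lemma exp_op_lipschitz_bound r p : 1 <= r -> cs p ->
  exists2 q, cs q & forall s t x, 0 <= s <= r -> 0 <= t <= r ->
    p (exp_op t x - exp_op s x) <= `|t - s| * q x.
Proof.
move=> r1 p_cs; have [q q_cs pq] := exp_sum_lipschitz_bound r1 p_cs.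
exists q => // s t x sr tr; have /andP[s0 _] := sr; have /andP[t0 _] := tr.
apply: (cvg_seminorm_le p_cs (@exp_sum_cvg _ _ t0) (@exp_sum_cvg _ _ s0)).
by apply: nearW => N; exact: pq.
Qed.

Lemma exp_op_quadratic_bound p : cs p ->
  exists2 q, cs q & forall t x, 0 <= t <= 1 ->
    p (exp_op t x - (x + of_real t *: A x)) <= t ^+ 2 * q x.
Proof.
move=> p_cs; have [q q_cs pq] := exp_sum_quadratic_bound p_cs.
exists q => // t x t01; have /andP[t0 _] := t01.
apply: (cvg_seminorm_le (v := fun=> x + of_real t *: A x) p_cs
  (@exp_sum_cvg _ _ t0)); first exact: cvg_cst.
by near=> N; apply: pq => //; near: N; exact: nbhs_infty_ge.
Unshelve. all: by end_near. Qed.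

(** The tail estimate at m = 0, where the partial sum is empty. *)
Lemma exp_op_bound t p : 0 <= t -> cs p ->
  exists2 q, cs q & forall x, p (exp_op t x) <= q x.
Proof.
move=> t0 p_cs; have t10 : 0 < t + 1 by rewrite ltr_wpDl.
have [q q_cs pq] := exp_op_tail_bound t10 p_cs.
exists q => // x; have := pq t 0%N x.
by rewrite /exp_sum big_nil subr0 expr0 mul1r t0/= lerDl; exact.
Qed.

Lemma exp_op_linear t : 0 <= t -> linear (exp_op t).
Proof.
move=> t0 a x y; apply: cs_separating => // p p_cs.
have cvg_lin : a *: exp_sum t N x + exp_sum t N y @[N --> \oo] -->
    a *: exp_op t x + exp_op t y.
  apply: (@continuous2_cvg _ X X X _ _ _ _ +%R).
  - exact: (@add_continuous X (_, _)).
  - apply: (@continuous2_cvg _ (scalars R k)^o X X _ _ (fun=> a) _ *:%R).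
    + exact: (@scale_continuous _ X (_, _)).
    + exact: cvg_cst.
    + exact: exp_sum_cvg.
  - exact: exp_sum_cvg.
apply: (cvg_seminorm_le p_cs (@exp_sum_cvg _ _ t0) cvg_lin).
apply: nearW => N; rewrite exp_sum_linear subrr.
by have [ps _] := p_cs; rewrite (seminorm0 ps).
Qed.

Lemma exp_op_continuous_linear t : 0 <= t -> continuous_linear (exp_op t).
Proof.
move=> t0; split; first exact: exp_op_linear.
apply: linear_continuous_cs; first exact: exp_op_linear.
by move=> p; exact: exp_op_bound.
Qed.

(** The quadratic estimate at t = 0 has right-hand side 0. *)
Lemma exp_op0 x : exp_op 0 x = x.
Proof.
apply: cs_separating => // p p_cs.
have [q q_cs pq] := exp_op_quadratic_bound p_cs.
have := pq 0 x; rewrite rmorph0 scale0r addr0 expr0n mul0r lexx ler01.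
exact.
Qed.

(** T(t + s) x is joined to T(t) T(s) x through S(t + s) x, S(t) S(s) x and
S(t) T(s) x, where S(t) is the partial sum of order N at t; each of the four
steps costs at most a multiple of 2^-N. *)
Lemma exp_opD t s : 0 <= t -> 0 <= s -> exp_op (t + s) = exp_op t \o exp_op s.
Proof.
move=> t0 s0; apply/funext => x /=; apply: cs_separating => // p p_cs.
have [ps _] := p_cs.
have r0 : 0 < t + s + 1 by rewrite ltr_wpDl// addr_ge0.
have tr : 0 <= t <= t + s + 1 by rewrite t0/= -addrA lerDl addr_ge0.
have sr : 0 <= s <= t + s + 1 by rewrite s0/= addrAC lerDr addr_ge0.
have tsr : 0 <= t + s <= t + s + 1 by rewrite addr_ge0//= lerDl.
have [q1 q1_cs tail] := exp_op_tail_bound r0 p_cs.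
have [q2 q2_cs mul] := exp_sum_semigroup_bound r0 p_cs.
have [q3 q3_cs bnd] := exp_sum_tail_bound r0 p_cs.
have [q4 q4_cs tail3] := exp_op_tail_bound r0 q3_cs.
pose C := q1 x + q2 x + q4 x + q1 (exp_op s x).
have dist N : p (exp_op (t + s) x - exp_op t (exp_op s x)) <= 2^-1 ^+ N * C.
  have h1 := tail (t + s) N x tsr.
  have h2 : p (exp_sum (t + s) N x - exp_sum t N (exp_sum s N x)) <=
      2^-1 ^+ N * q2 x.
    by rewrite (seminormC ps); apply: mul => //; case/andP: tsr.
  have h3 : p (exp_sum t N (exp_sum s N x) - exp_sum t N (exp_op s x)) <=
      2^-1 ^+ N * q4 x.
    rewrite (seminormC ps).
    have -> : exp_sum t N (exp_op s x) - exp_sum t N (exp_sum s N x) =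
        exp_sum t N (exp_op s x - exp_sum s N x) -
        exp_sum t 0 (exp_op s x - exp_sum s N x).
      rewrite [exp_sum t 0 _]big_nil subr0 addrC -scaleN1r -exp_sum_linear.
      by rewrite scaleN1r addrC.
    apply: le_trans (bnd t 0%N N _ tr (leq0n _)) _.
    by rewrite expr0 mul1r; exact: tail3.
  have h4 : p (exp_sum t N (exp_op s x) - exp_op t (exp_op s x)) <=
      2^-1 ^+ N * q1 (exp_op s x).
    by rewrite (seminormC ps); exact: tail.
  rewrite -(subrKA (exp_sum t N (exp_op s x))).
  rewrite (le_trans (seminormD ps _ _))// /C mulrDr lerD//.
  rewrite -(subrKA (exp_sum t N (exp_sum s N x))).
  rewrite (le_trans (seminormD ps _ _))// mulrDr lerD//.
  rewrite -(subrKA (exp_sum (t + s) N x)).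
  by rewrite (le_trans (seminormD ps _ _))// mulrDr lerD.
apply: (ler_cvg_to (cvg_cst _) (cvg_half_pow C)).
by apply: nearW => N; exact: dist.
Qed.

(** Local Lipschitz continuity on [0, t0 + 1], in the form needed for
convergence both in L_b(X) and at each point. *)
Lemma exp_op_near t0 p : 0 <= t0 -> cs p ->
  exists2 q, cs q & forall e : R, 0 < e ->
    \forall t \near within [set t : R | 0 <= t] (nbhs t0),
      forall x, p (exp_op t x - exp_op t0 x) <= e * q x.
Proof.
move=> t00 p_cs; have r1 : 1 <= t0 + 1 by rewrite lerDr.
have [q q_cs pq] := exp_op_lipschitz_bound r1 p_cs.
exists q => // e e0; rewrite near_withinE; near=> t => t_ge0 x.
have qx0 : 0 <= q x by case: q_cs => -[].
have tt0 : `|t0 - t| < Num.min e 1.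
  by near: t; apply: cvgr_dist_lt => //; rewrite lt_min e0 ltr01.
move: tt0; rewrite lt_min => /andP[te t1].
apply: le_trans (pq t0 t x _ _) _.
- by rewrite t00/= lerDl.
- by rewrite t_ge0/= -lerBlDl (le_trans (ler_norm _))// distrC ltW.
- by rewrite ler_wpM2r// distrC ltW.
Unshelve. all: by end_near. Qed.

Lemma exp_op_strongly_continuous x t0 : 0 <= t0 ->
  exp_op t x @[t --> within [set t : R | 0 <= t] (nbhs t0)] --> exp_op t0 x.
Proof.
move=> t00; apply: cvg_cs => p p_cs e e0.
have [q q_cs pq] := exp_op_near t00 p_cs.
have qx0 : 0 <= q x by case: q_cs => -[].
have q10 : 0 < q x + 1 by rewrite ltr_wpDl.
apply: filterS (pq (e / (q x + 1)) _); last by rewrite divr_gt0.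
move=> t /(_ x) /le_lt_trans; apply.
by rewrite mulrAC ltr_pdivrMr// ltr_pM2l// ltrDl.
Qed.

Lemma exp_op_uniformly_continuous_semigroup :
  uniformly_continuous_semigroup exp_op.
Proof.
split=> [|t0 t00].
  split; [exact: exp_op_continuous_linear|exact: exp_op0|exact: exp_opD|].
  exact: exp_op_strongly_continuous.
apply: Lb_cvg_relative => p p_cs; exact: exp_op_near.
Qed.

(** The quadratic estimate divided by t. *)
Lemma exp_op_generator x : generator_value exp_op x (A x).
Proof.
apply: cvg_cs => p p_cs e e0; have [ps _] := p_cs.
have [q q_cs pq] := exp_op_quadratic_bound p_cs.
have qx0 : 0 <= q x by case: q_cs => -[].
have q10 : 0 < q x + 1 by rewrite ltr_wpDl.
near=> t.
have t0 : 0 < t by near: t; exact: nbhs_right_gt.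
have t1 : t <= 1 by near: t; exact: nbhs_right_le.
have te : t < e / (q x + 1) by near: t; apply: nbhs_right_lt; rewrite divr_gt0.
have -> : of_real t^-1 *: (exp_op t x - x) - A x =
    of_real t^-1 *: (exp_op t x - (x + of_real t *: A x)).
  rewrite opprD addrA [in RHS]scalerBr scalerA -rmorphM mulVf ?gt_eqF//.
  by rewrite rmorph1 scale1r.
rewrite (seminormZ ps) gtr0_norm ?invr_gt0// ltr_pdivrMl//.
have t01 : 0 <= t <= 1 by rewrite ltW.
rewrite (le_lt_trans (pq t x t01))// expr2 -mulrA ltr_pM2l//.
rewrite ltr_pdivlMr// in te; apply: le_lt_trans te.
by rewrite ler_wpM2l ?ltW// ltrDl.
Unshelve. all: by end_near. Qed.

Lemma exp_op_series t : 0 <= t -> Lb_cvg (exp_sum t @ \oo) (exp_op t).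
Proof.
move=> t0; apply: Lb_cvg_relative => p p_cs; have [ps _] := p_cs.
have t10 : 0 < t + 1 by rewrite ltr_wpDl.
have [q q_cs pq] := exp_op_tail_bound t10 p_cs.
exists q => // e e0; have /cvgr_le := cvg_half_pow 1.
move=> /(_ e e0); apply: filterS => N; rewrite mulr1 => Ne x.
have qx0 : 0 <= q x by case: q_cs => -[].
rewrite (seminormC ps) (le_trans (pq t N x _))//; first by rewrite t0/= lerDl.
exact: ler_wpM2r.
Qed.

End ExponentialOfOperator.

End ExponentialSeries.

Theorem theorem2 (R : realType) (k : scalar_kind) (X : tvsType (scalars R k))
    (A : X -> X)
    (X_hausdorff : hausdorff_space X)
    (X_complete : sequentially_complete X)
    (A_L : continuous_linear A)
    (A_bound : forall (r : R) (p : X -> R), 0 < r -> cs p ->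
       exists (q : X -> R) (mu : nat -> R),
         [/\ cs q,
             forall n, 0 < mu n,
             forall n x, p (iter n A x) <= mu n * q x &
             cvgn (series (fun n => mu n / n`!%:R * r ^+ n))]) :
  exists T : R -> X -> X,
    [/\ uniformly_continuous_semigroup T,
        generates A T &
        forall t : R, 0 <= t ->
          Lb_cvg (series (fun n => of_real k (t ^+ n / n`!%:R) *: iter n A) @ \oo)
                 (T t)].
Proof.
exists (exp_op A); split.
- exact: exp_op_uniformly_continuous_semigroup.
- have gen x : generator_value (exp_op A) x (A x) by exact: exp_op_generator.
  by split=> //; rewrite -subTset => x _; exists (A x).
- move=> t t0.
  have -> : series (fun n => of_real k (t ^+ n / n`!%:R) *: iter n A) =
      exp_sum A t.
    by apply/funext => N; rewrite /series/= fct_sumE.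
  exact: exp_op_series.
Qed.
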